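(* Let $\varphi$ be a state on $\mathbb{C}\langle x_1,\ldots,x_d\rangle$ with a MOPS, let $\{\mathcal{T}_i^{(k)},\mathcal{C}^{(k)}\}$ be the matrices in its Fock space representation, whose entries are the coefficients in the recursion relation for the MOPS, and let $M(\mathbf{z})$ be its moment generating function. Then $$1+M(\mathbf{z})=\cfrac{1}{1-\sum_{i_0}z_{i_0}\mathcal{T}_{i_0}^{(0)}-\cfrac{\sum_{j_1}z_{j_1}E_{j_1}\mathcal{C}^{(1)}\,\big|\,\sum_{k_1}E_{k_1}z_{k_1}}{1-\sum_{i_1}z_{i_1}\mathcal{T}_{i_1}^{(1)}-\cfrac{\sum_{j_2}z_{j_2}E_{j_2}\mathcal{C}^{(2)}\,\big|\,\sum_{k_2}E_{k_2}z_{k_2}}{1-\sum_{i_2}z_{i_2}\mathcal{T}_{i_2}^{(2)}-\cfrac{\sum_{j_3}z_{j_3}E_{j_3}\mathcal{C}^{(3)}\,\big|\,\sum_{k_3}E_{k_3}z_{k_3}}{1-\cdots}}}}$$ where for $A,B\in M_{d^k\times d^k}\simeq M_{d\times d}\otimes\cdots\otimes M_{d\times d}$, $$\frac{E_iA\,|\,E_j}{B}=\bigl\langle e_i\otimes I\otimes\cdots\otimes I,\;AB^{-1}(e_j\otimes I\otimes\cdots\otimes I)\bigr\rangle\in M_{d^{k-1}\times d^{k-1}}.$$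
   Context: States and MOPS: a state on $\mathbb{C}\langle\mathbf{x}\rangle$ (polynomials in non-commuting self-adjoint $x_1,\ldots,x_d$) is a unital linear functional with $\varphi[P^*]=\overline{\varphi[P]}$, $\varphi[P^*P]\ge0$. A monic orthogonal polynomial system (MOPS) is a family $P_{\vec u}=x_{\vec u}+$ lower-order terms, $P_\emptyset=1$, indexed by multi-indices $\vec u\in\{1,\ldots,d\}^k$, with $\varphi[P_{\vec u}^*P_{\vec v}]=0$ for $\vec u\ne\vec v$. $M(\mathbf{z})=\sum_{|\vec u|\ge1}\varphi[x_{\vec u}]z_{\vec u}$ in non-commuting indeterminates $\mathbf{z}$. Recursion: for suitable coefficients $B_{i,\vec w,\vec u}$ and $\mathcal{C}_{\vec u}\ge0$, the MOPS satisfies $x_i=P_i+B_{i,\emptyset,\emptyset}$, and for $|\vec u|\ge1$, $$x_iP_{\vec u}=P_{(i,\vec u)}+\sum_{|\vec w|=|\vec u|}B_{i,\vec w,\vec u}P_{\vec w}+\delta_{i,u(1)}\mathcal{C}_{\vec u}P_{(u(2),\ldots,u(k))}.$$ Write $\mathcal{H}=\mathbb{C}^d$ with orthonormal basis $e_1,\ldots,e_d$ and $e_{\vec u}=e_{u(1)}\otimes\cdots\otimes e_{u(k)}$. $\mathcal{C}^{(k)}$ ($k\ge1$) is the diagonal $d^k\times d^k$ matrix $\mathcal{C}^{(k)}e_{\vec u}=\mathcal{C}_{\vec u}e_{\vec u}$, and $\mathcal{T}_i^{(k)}$ ($k\ge0$) the $d^k\times d^k$ matrix $\mathcal{T}_i^{(k)}e_{\vec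 u}=\sum_{|\vec w|=k}B_{i,\vec w,\vec u}e_{\vec w}$ (a scalar for $k=0$). They satisfy $(\mathcal{T}_i^{(k)})^*\mathcal{K}^{(k)}=\mathcal{K}^{(k)}\mathcal{T}_i^{(k)}$ with $\mathcal{K}^{(k)}=(I^{\otimes(k-1)}\otimes\mathcal{C}^{(1)})\cdots(I\otimes\mathcal{C}^{(k-1)})\mathcal{C}^{(k)}$. Fock representation: on $\mathbb{C}\Omega\oplus\bigoplus_{k\ge1}\mathcal{H}^{\otimes k}$ let $\mathcal{X}_i=a_i^++\mathcal{T}_i+a_i^-\mathcal{C}$, where $a_i^+$ tensors by $e_i$ on the left ($a_i^+\Omega=e_i$), $a_i^-e_{\vec u}=\delta_{i,u(1)}e_{(u(2),\ldots,u(k))}$, $a_i^-e_j=\delta_{ij}\Omega$, $a_i^-\Omega=0$, and $\mathcal{T}_i,\mathcal{C}$ act on the $k$-th component as $\mathcal{T}_i^{(k)},\mathcal{C}^{(k)}$. Then $\varphi[P(\mathbf{x})]=\langle\Omega,P(\mathcal{X}_1,\ldots,\mathcal{X}_d)\Omega\rangle$ (the coefficient of $\Omega$). Meaning of the continued fraction: the denominator at level $k$ is a $d^k\times d^k$ matrix with entries in $\mathbb{C}\langle\langle\mathbf{z}\rangle\rangle$ (formal power series in the non-commuting $z_i$). The fraction with denominator $B$ at level $k\ge1$ stands for $\sum_{j,l}z_j\frac{E_j\mathcal{C}^{(k)}|E_l}{B}z_l$, where $\frac{E_j\mathcal{C}^{(k)}|E_l}{B}$ is the $d^{k-1}\times d^{k-1}$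 matrix whose $(\vec v,\vec w)$ entry is the $((j,\vec v),(l,\vec w))$ entry of $\mathcal{C}^{(k)}B^{-1}$ (multi-indices of length $k-1$). The infinite fraction is the coefficientwise limit of its truncations at level $N$ (omitting the fraction inside the level-$N$ denominator) as $N\to\infty$. *)

(* Defs.v *)
From HB Require Import structures.
From mathcomp Require Import all_boot all_order all_algebra.
From mathcomp Require Import finmap monalg.
From mathcomp Require Import complex.
From mathcomp Require Import boolp classical_sets functions reals.

Set Implicit Arguments.
Unset Strict Implicit.
Unset Printing Implicit Defensive.

Import Order.TTheory GRing.Theory Num.Theory.
Local Open Scope ring_scope.

(* The ring K<<z_1, ..., z_d>>: a series is the function that sends a word to *)
(* its coefficient.  The alias keeps the convolution product apart from the   *)
(* pointwise product that function types already carry.                       *)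
Definition ncps (K : nzRingType) (d : nat) : Type := seq 'I_d -> K.

Section NCPowerSeries.
Context {K : nzRingType} {d : nat}.

HB.instance Definition _ := GRing.Zmodule.copy (ncps K d) (seq 'I_d -> K).

Implicit Types (f g h : ncps K d) (w : seq 'I_d) (c : K).

Definition pscoef w f : K := f w.

Definition psC c : ncps K d := fun w => if w is [::] then c else 0.

Definition psX (i : 'I_d) : ncps K d := fun w => (w == [:: i])%:R.

Definition psmul f g : ncps K d :=
  fun w => \sum_(k < (size w).+1) f (take k w) * g (drop k w).

Lemma psP f g : (forall w, pscoef w f = pscoef w g) -> f = g.
Proof. by move=> fg; apply/funext. Qed.

Lemma pscoefD w f g : pscoef w (f + g) = pscoef w f + pscoef w g.
Proof. by []. Qed.

Lemma pscoefN w f : pscoef w (- f) = - pscoef w f.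
Proof. by []. Qed.

Lemma pscoef0 w : pscoef w (0 : ncps K d) = 0.
Proof. by []. Qed.

Lemma pscoef_sum w (I : Type) (r : seq I) (P : pred I) (F : I -> ncps K d) :
  pscoef w (\sum_(i <- r | P i) F i) = \sum_(i <- r | P i) pscoef w (F i).
Proof. by elim/big_rec2: _ => // i x y _ <-; rewrite pscoefD. Qed.

Let shift (a : 'I_d) f : ncps K d := fun w => f (a :: w).

Lemma psmul_nil f g : psmul f g [::] = f [::] * g [::].
Proof. by rewrite /psmul big_ord_recl big_ord0 addr0. Qed.

Lemma psmul_cons f g a w :
  psmul f g (a :: w) = f [::] * g (a :: w) + psmul (shift a f) g w.
Proof. by rewrite /psmul big_ord_recl. Qed.

Fact psmulDl : left_distributive psmul +%R.
Proof.
move=> f g h; apply/psP => w; rewrite pscoefD /pscoef /psmul -big_split /=.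
by apply: eq_bigr => k _; rewrite -mulrDl.
Qed.

Fact psmulDr : right_distributive psmul +%R.
Proof.
move=> f g h; apply/psP => w; rewrite pscoefD /pscoef /psmul -big_split /=.
by apply: eq_bigr => k _; rewrite -mulrDr.
Qed.

Fact psmulA : associative psmul.
Proof.
move=> f g h; apply/psP => w; rewrite /pscoef.
elim: w f => [|a w IHw] f; first by rewrite !psmul_nil mulrA.
rewrite !psmul_cons IHw psmul_nil mulrDr -addrA mulrA; congr (_ + _).
have -> : shift a (psmul f g) =
    (fun w => f [::] * shift a g w) + psmul (shift a f) g :> ncps K d.
  by apply/funext => v; rewrite /shift psmul_cons.
rewrite psmulDl -[RHS]/(psmul _ _ w + psmul _ _ w); congr (_ + _).
by rewrite /psmul mulr_sumr; apply: eq_bigr => k _; rewrite mulrA.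
Qed.

Fact psmul1l : left_id (psC 1) psmul.
Proof.
move=> f; apply/psP => -[|a w]; rewrite /pscoef.
  by rewrite psmul_nil mul1r.
rewrite psmul_cons mul1r [psmul _ _ _]big1 ?addr0 // => k _.
by rewrite /shift mul0r.
Qed.

Fact psmul1r : right_id (psC 1) psmul.
Proof.
move=> f; apply/psP => w; rewrite /pscoef.
elim: w f => [|a w IHw] f; first by rewrite psmul_nil mulr1.
by rewrite psmul_cons IHw mulr0 add0r.
Qed.

Fact ps1_neq0 : psC 1 != 0.
Proof.
by apply/eqP => /(congr1 (pscoef [::])) /eqP; rewrite pscoef0 oner_eq0.
Qed.

HB.instance Definition _ := GRing.Zmodule_isNzRing.Build (ncps K d)
  psmulA psmul1l psmul1r psmulDl psmulDr ps1_neq0.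

End NCPowerSeries.

(* Coefficientwise limit of formal power series: K carries the discrete       *)
(* topology, so each coefficient is eventually equal to its limit, which also *)
(* gives convergence for any other topology on K.                             *)
Definition pslim (K : nzRingType) (d : nat) (F : nat -> ncps K d)
    (L : ncps K d) : Prop :=
  forall w, exists N0, forall N, (N0 <= N)%N -> pscoef w (F N) = pscoef w L.

(* The matrix ring over a non-commutative ring has no unitRingType instance;  *)
(* ncinvmx B is the two-sided inverse of B when there is one, and B otherwise *)
(* (cf_denomV below shows that the second case does not occur in cf_trunc).   *)
Definition ncinvmx (S : nzRingType) (n : nat) (B : 'M[S]_n) : 'M[S]_n :=
  xget B [set B' : 'M[S]_n | B *m B' = 1%:M /\ B' *m B = 1%:M].

(* C<x_1, ..., x_d>, the monoid algebra of the free monoid of words. *)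
Notation ncpoly R d := {malg R[i][{fmonom 'I_d}]}.

Section FreeAlgebra.
Variables (R : realType) (d : nat).
Local Notation C := R[i].
Local Notation ncpoly := (ncpoly R d).

Definition ncX (i : 'I_d) : ncpoly := << FMonom [:: i] >>.

Definition ncword (u : seq 'I_d) : ncpoly := << FMonom u >>.

Definition ncstar (p : ncpoly) : ncpoly :=
  \sum_(m <- msupp p) (p@_m)^* *: ncword (rev m).

Definition is_state (phi : {scalar ncpoly}) : Prop :=
  [/\ phi 1 = 1,
      forall p, phi (ncstar p) = (phi p)^*
    & forall p, 0 <= phi (ncstar p * p)].

Definition deg_lt (p : ncpoly) (n : nat) : Prop :=
  forall m, m \in msupp p -> (fdeg m < n)%N.

Definition is_MOPS (phi : {scalar ncpoly}) (P : seq 'I_d -> ncpoly) : Prop :=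
  [/\ P [::] = 1,
      forall u, deg_lt (P u - ncword u) (size u)
    & forall u v, u != v -> phi (ncstar (P u) * P v) = 0].

Definition momentGF (phi : {scalar ncpoly}) : ncps C d :=
  fun w => if w is [::] then 0 else phi (ncword w).

(* B i w u is B_{i,w,u} and c u is C_u; the values of B off |w| = |u| and of  *)
(* c at the empty word play no role.                                          *)
Definition MOPS_recursion (P : seq 'I_d -> ncpoly)
    (B : 'I_d -> seq 'I_d -> seq 'I_d -> C) (c : seq 'I_d -> C) : Prop :=
  [/\ forall u, (0 < size u)%N -> 0 <= c u,
      forall i, ncX i = P [:: i] + (B i [::] [::])%:A
    & forall i j u, let v := j :: u in
        ncX i * P v = P (i :: v)
          + \sum_(w : (size v).-tuple 'I_d) B i w v *: P w
          + ((i == j)%:R * c v) *: P u].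

End FreeAlgebra.

(* M_{d^k x d^k}: rows and columns are indexed by the multi-indices of length *)
(* k through enum_rank/enum_val; #|{: k.-tuple 'I_d}| = d ^ k by card_tuple.  *)
Notation "''MI_' ( d , k )" := #|{: k.-tuple 'I_d}|
  (at level 8, format "''MI_' ( d ,  k )").

Definition mi_val (d k : nat) (a : 'I_('MI_(d, k))) : k.-tuple 'I_d :=
  enum_val a.

Definition mi_cons (d k : nat) (j : 'I_d) (a : 'I_('MI_(d, k))) :
    'I_('MI_(d, k.+1)) :=
  enum_rank [tuple of j :: mi_val a].

Section ContinuedFraction.
Variables (R : realType) (d : nat).
Local Notation C := R[i].
Local Notation S := (ncps C d).
Variables (B : 'I_d -> seq 'I_d -> seq 'I_d -> C) (c : seq 'I_d -> C).

Definition Tmx (k : nat) (i : 'I_d) : 'M[C]_('MI_(d, k)) :=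
  \matrix_(a, b) B i (mi_val a) (mi_val b).

Definition Cmx (k : nat) : 'M[C]_('MI_(d, k)) :=
  \matrix_(a, b) (c (mi_val b) *+ (a == b)).

(* (E_j A | E_l) / D *)
Definition Efrac (k : nat) (j l : 'I_d) (A : 'M[C]_('MI_(d, k.+1)))
    (D : 'M[S]_('MI_(d, k.+1))) : 'M[S]_('MI_(d, k)) :=
  \matrix_(a, b) (map_mx psC A *m ncinvmx D) (mi_cons j a) (mi_cons l b).

(* The denominator at level k when r further levels are kept below it. *)
Fixpoint cf_denom (r k : nat) : 'M[S]_('MI_(d, k)) :=
  let D0 := 1%:M - \sum_i psX i *: map_mx psC (Tmx k i) in
  if r is r'.+1 then
    D0 - \sum_j \sum_l
           map_mx (fun s => psX j * s * psX l)
                  (Efrac j l (Cmx k.+1) (cf_denom r' k.+1))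
  else D0.

Definition cf_trunc (N : nat) : S :=
  ncinvmx (cf_denom N 0) (enum_rank [tuple]) (enum_rank [tuple]).

End ContinuedFraction.

Section Invertibility.
Variables (K : nzRingType) (d n : nat).
Local Notation S := (ncps K d).
Implicit Types A X Y : 'M[S]_n.

Let vanish m X := forall a b w, (size w < m)%N -> pscoef w (X a b) = 0.

Let vanishD m X Y : vanish m X -> vanish m Y -> vanish m (X + Y).
Proof. by move=> hX hY a b w wm; rewrite mxE pscoefD hX ?hY ?addr0. Qed.

Let vanishN m X : vanish m X -> vanish m (- X).
Proof. by move=> hX a b w wm; rewrite mxE pscoefN hX ?oppr0. Qed.

Let vanishS m X : vanish m.+1 X -> vanish m X.
Proof. by move=> hX a b w wm; rewrite hX // ltnW. Qed.

Let vanishM p q X Y : vanish p X -> vanish q Y -> vanish (p + q) (X *m Y).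
Proof.
move=> hX hY a b w wpq; rewrite mxE pscoef_sum big1 // => e _.
rewrite [LHS]big1 // => -[k /= kw] _.
have [kp|pk] := ltnP k p.
  by rewrite [X a e _]hX ?mul0r // size_take_min gtn_min kp.
rewrite [Y e b _]hY ?mulr0 // size_drop.
by rewrite ltn_subLR ?(leq_trans wpq) ?leq_add2r // -ltnS.
Qed.

Let nsum A m := iter m (fun X => 1%:M + A *m X) 1%:M.
Let npow A m := iter m (mulmx A) A.

Let nsumS A m : nsum A m.+1 = nsum A m + npow A m.
Proof.
elim: m => [|m IHm]; first by rewrite /nsum /npow /= mulmx1.
by rewrite -[LHS]/(1%:M + A *m nsum A m.+1) {1}IHm mulmxDr addrA.
Qed.

Let npowC A m : A *m npow A m = npow A m *m A.
Proof. by elim: m => //= m IHm; rewrite {1}IHm -mulmxA. Qed.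

Let nsumC A m : A *m nsum A m = nsum A m *m A.
Proof.
elim: m => [|m IHm]; first by rewrite /nsum /= mulmx1 mul1mx.
by rewrite nsumS mulmxDr mulmxDl IHm npowC.
Qed.

Let nsum_npow A m : nsum A m - A *m nsum A m = 1%:M - npow A m.
Proof.
have e : 1%:M + A *m nsum A m = nsum A m + npow A m := nsumS A m.
by apply/eqP; rewrite subr_eq addrAC e addrK.
Qed.

Let vanish_npow A m : vanish 1 A -> vanish m.+1 (npow A m).
Proof.
move=> hA; elim: m => //= m IHm.
by rewrite -[m.+2]add1n; apply: vanishM.
Qed.

Let nlim A : 'M[S]_n := 
  \matrix_(a, b) (fun w => pscoef w (nsum A (size w) a b)).

Let nlimE A m : vanish 1 A -> vanish m.+1 (nlim A - nsum A m).
Proof.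
move=> hA a b w wm; rewrite mxE pscoefD mxE mxE pscoefN [X in X - _]/pscoef.
rewrite ltnS in wm; rewrite -(subnKC wm); elim: (m - size w)%N => [|k IHk].
  by rewrite addn0 subrr.
rewrite addnS nsumS mxE pscoefD [pscoef w (npow _ _ _ _)]vanish_npow ?addr0 //.
by rewrite ltnS leq_addr.
Qed.

Let vanish_eq X Y : (forall m, vanish m (X - Y)) -> X = Y.
Proof.
move=> h; apply/matrixP => a b; apply: psP => w; apply/eqP.
have := h (size w).+1 a b w (leqnn _).
by rewrite mxE mxE pscoefD pscoefN => /eqP; rewrite subr_eq0.
Qed.

Lemma ps_mx_inv A :
    (forall a b, pscoef [::] (A a b) = 0) ->
  exists X, (1%:M - A) *m X = 1%:M /\ X *m (1%:M - A) = 1%:M.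
Proof.
move=> A0; have hA : vanish 1 A by move=> a b [].
exists (nlim A); split; apply: vanish_eq => m.
- rewrite mulmxBl mul1mx.
  have -> : nlim A - A *m nlim A - 1%:M =
      (nlim A - nsum A m) - A *m (nlim A - nsum A m) - npow A m.
    rewrite mulmxBr opprD addrACA -opprD nsum_npow opprB.
    by rewrite [npow A m - _]addrC [in RHS]addrA addrK.
  apply: vanishD; [apply: vanishD|]; do ?apply: vanishN; apply: vanishS.
  + exact: nlimE.
  + by apply: vanishS; rewrite -[m.+2]add1n; apply: vanishM => //; apply: nlimE.
  + exact: vanish_npow.
- rewrite mulmxBr mulmx1.
  have -> : nlim A - nlim A *m A - 1%:M =
      (nlim A - nsum A m) - (nlim A - nsum A m) *m A - npow A m.
    rewrite mulmxBl opprD addrACA -opprD -nsumC nsum_npow opprB.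
    by rewrite [npow A m - _]addrC [in RHS]addrA addrK.
  apply: vanishD; [apply: vanishD|]; do ?apply: vanishN; apply: vanishS.
  + exact: nlimE.
  + by apply: vanishS; rewrite -[m.+2]addn1; apply: vanishM => //; apply: nlimE.
  + exact: vanish_npow.
Qed.

End Invertibility.

Lemma cf_denomV (R : realType) (d : nat)
    (B : 'I_d -> seq 'I_d -> seq 'I_d -> R[i]) (c : seq 'I_d -> R[i])
    (r k : nat) (D := cf_denom B c r k) :
  D *m ncinvmx D = 1%:M /\ ncinvmx D *m D = 1%:M.
Proof.
suff [X DX] : exists X, D *m X = 1%:M /\ X *m D = 1%:M.
  by rewrite /ncinvmx; case: xgetP => [Y _ //|/(_ X)].
have zX i (s : ncps R[i] d) : pscoef [::] (psX i * s) = 0.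
  by rewrite [LHS]big_ord1 [psX i _]/= mul0r.
have T0 : forall a b, pscoef [::]
    ((\sum_i psX i *: map_mx psC (Tmx B k i)) a b) = 0.
  by move=> a b; rewrite summxE pscoef_sum big1 // => i _; rewrite mxE zX.
rewrite {}/D; case: r => [|r] /=; first exact: ps_mx_inv.
rewrite -addrA -opprD; apply: ps_mx_inv => a b.
rewrite mxE pscoefD T0 add0r summxE pscoef_sum big1 // => j _.
by rewrite summxE pscoef_sum big1 // => l _; rewrite mxE -mulrA zX.
Qed.

(* Main.v *)
Require Import Defs.
From mathcomp Require Import all_boot all_order all_algebra.
From mathcomp Require Import finmap monalg complex.
From mathcomp Require Import reals.

Set Implicit Arguments.
Unset Strict Implicit.
Unset Printing Implicit Defensive.

Import GRing.Theory Num.Theory.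
Local Open Scope ring_scope.

(** Let F_v be the series whose coefficient at the word w is phi[x_w P_v]
    ([mixedGF]).  Orthogonality gives phi[P_v] = 0 for v nonempty, and P_nil is
    1, so F_nil is 1 + M(z).

    To compute phi[x_w x_i P_v], expand x_i P_v by the recursion of the MOPS.
    Removing the last letter of the word in this way expresses F_v through the
    series at the neighbouring levels.  Let F_k be the row vector of the F_v
    with |v| = k.  Then ([levelrow_rec])
<<
      F_k (1 - sum_i z_i T_i^(k)) = L_k + sum_l F_(k+1)[l, .] z_l,
>>
    where L_0 = 1 and, for v = (j, u), the entry of L_(k+1) at v is
    F_u z_j C_v ([lowered]).  If D is any invertible matrix and F_(k+1) D =
    L_(k+1), then sum_l F_(k+1)[l, .] z_l is F_k times the fraction
    sum_(j,l) z_j (E_j C^(k+1) | E_l)/D z_l ([contract_loweredV]).  Moving it to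
    the left-hand side yields F_k D' = L_k with D' the denominator one level up;
    this is how the continued fraction arises, and at level 0 it says
    F_nil = 1 / D'.

    For a truncated fraction the relation F_k D = L_k holds up to an error.
    With no level kept below the k-th one, the error is the whole contribution
    of F_(k+1).  Each further level multiplies the error by an invertible matrix
    and then by some z_l, hence raises its order in z by at least one
    ([levelrow_denom]).  So the truncation at level N has the right coefficients
    at all words of length less than N. *)

(** * Coefficients of noncommutative power series *)

Section PowerSeries.
Variables (K : nzRingType) (d : nat).
Implicit Types (f g : ncps K d) (w : seq 'I_d).

Lemma pscoefM w f g :
  pscoef w (f * g) =
    \sum_(k < (size w).+1) pscoef (take k w) f * pscoef (drop k w) g.
Proof. by []. Qed.

Lemma pscoef1 w : pscoef w (1 : ncps K d) = (w == [::])%:R.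
Proof. by case: w. Qed.

Lemma pscoefMC w f x : pscoef w (f * psC x) = pscoef w f * x.
Proof.
rewrite pscoefM big_ord_recr /= take_size drop_size [pscoef _ (psC x)]/=.
rewrite big1 ?add0r // => -[k /= kw] _.
by rewrite /pscoef /psC (drop_nth (tnth (in_tuple w) (Ordinal kw))) ?mulr0.
Qed.

Lemma pscoefCM w f x : pscoef w (psC x * f) = x * pscoef w f.
Proof.
rewrite pscoefM big_ord_recl take0 drop0 [pscoef _ (psC x)]/=.
rewrite big1 ?addr0 // => -[k /= kw] _.
by case: w kw => // a w _; rewrite mul0r.
Qed.

Lemma pscoefMX_nil f i : pscoef [::] (f * psX i) = 0.
Proof. by rewrite pscoefM big_ord1 /= [pscoef _ (psX i)]/= mulr0. Qed.

(** Right multiplication by a variable appends a letter.  The expansions below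
    peel off the last letter of a word, so this and [pscoefMX_nil] give the
    coefficients of all the products that occur in them. *)
Lemma pscoefMX_rcons w f i j :
  pscoef (rcons w j) (f * psX i) = pscoef w f * (i == j)%:R.
Proof.
elim: w f => [|a w IHw] f; rewrite {1}/pscoef /=.
  rewrite [LHS]psmul_cons psmul_nil [psX i [::]]/= mulr0 addr0.
  by rewrite /psX eqseq_cons andbT eq_sym.
rewrite [LHS]psmul_cons [X in X + _](_ : _ = 0) ?add0r; last first.
  by rewrite /psX eqseq_cons; case: w {IHw} => [|? ?]; rewrite andbF mulr0.
exact: (IHw (fun v => f (a :: v))).
Qed.

Definition vanishes_below (m : nat) f :=
  forall w, (size w < m)%N -> pscoef w f = 0.

Lemma vanishes_below_sum m (I : finType) (F : I -> ncps K d) :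
  (forall i, vanishes_below m (F i)) -> vanishes_below m (\sum_i F i).
Proof. by move=> F0 w wm; rewrite pscoef_sum big1 // => i _; apply: F0. Qed.

Lemma vanishes_belowM m f g : vanishes_below m f -> vanishes_below m (f * g).
Proof.
move=> f0 w wm; rewrite pscoefM big1 // => -[k /= kw] _.
by rewrite f0 ?mul0r // (leq_ltn_trans _ wm) // size_take_min geq_minr.
Qed.

Lemma vanishes_belowMX m f i :
  vanishes_below m f -> vanishes_below m.+1 (f * psX i).
Proof.
move=> f0 w; case/lastP: w => [|w j]; first by rewrite pscoefMX_nil.
by rewrite size_rcons ltnS pscoefMX_rcons => wm; rewrite f0 ?mul0r.
Qed.

End PowerSeries.

(** * Sums over multi-indices *)

Section MultiIndices.
Variables (d k : nat).

Lemma mi_val_cons (j : 'I_d) (a : 'I_('MI_(d, k))) :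
  mi_val (mi_cons j a) = j :: mi_val a :> seq 'I_d.
Proof. by rewrite /mi_val /mi_cons enum_rankK. Qed.

Lemma sum_tuple_mi (V : nmodType) (F : k.-tuple 'I_d -> V) :
  \sum_(w : k.-tuple 'I_d) F w = \sum_(a : 'I_('MI_(d, k))) F (mi_val a).
Proof. by rewrite (reindex _ (onW_bij _ (@enum_val_bij _))). Qed.

Lemma sum_mi_cons (V : nmodType) (F : 'I_('MI_(d, k.+1)) -> V) :
  \sum_b F b = \sum_j \sum_a F (mi_cons j a).
Proof.
rewrite pair_big /= (reindex (fun p => mi_cons p.1 p.2)) //=.
exists (fun b => (thead (mi_val b), enum_rank (behead_tuple (mi_val b)))).
  move=> [j a] _ /=; congr pair.
    by rewrite /mi_val /mi_cons enum_rankK theadE.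
  rewrite -[RHS]enum_valK; congr enum_rank; apply: val_inj.
  by rewrite /= mi_val_cons.
move=> b _ /=; rewrite -[RHS]enum_valK; congr enum_rank.
rewrite /mi_val enum_rankK -/(mi_val b); apply: val_inj => /=.
by rewrite [in RHS](tuple_eta (mi_val b)).
Qed.

End MultiIndices.

(** The recursion of the MOPS sums over tuples of length [size v]; this changes
    the dependent index into a fixed level. *)
Lemma sum_sized_tuple (T : finType) (V : nmodType) (F : seq T -> V)
    (v : seq T) k : size v = k ->
  \sum_(w : (size v).-tuple T) F w = \sum_(w : k.-tuple T) F w.
Proof. by move=> <-. Qed.

(** * Words and orthogonal polynomials *)

(** Scalars are central even if the monoid does not commute, because they
    are carried by the unit monomial. *)
Lemma malg_scaleAr (K : monomType) (A : comNzRingType) (x : A)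
    (g h : {malg A[K]}) : g * (x *: h) = x *: (g * h).
Proof.
have comm : x%:MP * g = g * x%:MP.
  rewrite !malgM_def fgmulUg fgmulgU.
  by apply: eq_bigr => k _; rewrite mulrC mul1m mulm1.
by rewrite -!mul_malgC !mulrA comm.
Qed.

Section FreeAlgebraWords.
Variables (R : realType) (d : nat).

Lemma ncword_nil : ncword R ([::] : seq 'I_d) = 1.
Proof. by congr mkmalgU; apply/eqP; rewrite fmP fm1. Qed.

Lemma ncword_rcons (w : seq 'I_d) i :
  ncword R (rcons w i) = ncword R w * ncX R i.
Proof.
rewrite malgM_def fgmulUU mulr1; congr mkmalgU; apply/eqP.
by rewrite fmP fmM -cats1.
Qed.

Lemma ncstar1 : ncstar (1 : ncpoly R d) = 1.
Proof.
rewrite /ncstar -ncword_nil msuppU1 big_seq_fset1 mcoeffUU.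
by rewrite rmorph1 scale1r.
Qed.

(** This is orthogonality of [P v] to the constant polynomial [P [::]] = 1. *)
Lemma state_MOPS (phi : {scalar ncpoly R d}) (P : seq 'I_d -> ncpoly R d) v :
  is_state phi -> is_MOPS phi P -> phi (P v) = (v == [::])%:R.
Proof.
move=> [phi1 _ _] [P0 _ Port]; case: eqP => [->|/eqP v0]; first by rewrite P0.
by have := Port [::] v; rewrite eq_sym P0 ncstar1 mul1r => ->.
Qed.

End FreeAlgebraWords.

(** * Generating functions of the mixed moments *)

Section Expansion.
Variables (R : realType) (d : nat) (phi : {scalar ncpoly R d}).
Variables (P : seq 'I_d -> ncpoly R d).
Variables (B : 'I_d -> seq 'I_d -> seq 'I_d -> R[i]) (c : seq 'I_d -> R[i]).
Local Notation S := (ncps R[i] d).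

Definition mixedGF (v : seq 'I_d) : S :=
  fun w => phi (ncword R w * P v).

(** The part of [mixedGF v] produced by the annihilation term
    C_v P_u of x_j P_v, v = (j, u).  Nothing can be removed from the empty
    multi-index; there the value 1 is the initial condition phi[P_nil] = 1. *)
Definition lowered (v : seq 'I_d) : S :=
  if v is j :: u then mixedGF u * psX j * psC (c v) else 1.

Definition levelrow (F : seq 'I_d -> S) (k : nat) : 'rV[S]_('MI_(d, k)) :=
  \row_a F (mi_val a).

(** On rows of mixed moments, this is the part of level k that the creation
    terms P_(l, v) of x_l P_v fetch from level k + 1. *)
Definition contract (k : nat) (X : 'rV[S]_('MI_(d, k.+1))) :
    'rV[S]_('MI_(d, k)) :=
  \row_a \sum_l X 0 (mi_cons l a) * psX l.

Lemma contractB k (X Y : 'rV[S]_('MI_(d, k.+1))) :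
  contract (X - Y) = contract X - contract Y.
Proof.
apply/rowP => a; rewrite !mxE -sumrB; apply: eq_bigr => l _.
by rewrite !mxE mulrBl.
Qed.

Hypothesis phiP : forall v, phi (P v) = (v == [::])%:R.
Hypothesis P_nil : P [::] = 1.
Hypothesis P_rec : MOPS_recursion P B c.

Lemma mixedGF_nil : mixedGF [::] = 1 + momentGF phi.
Proof.
apply: psP => w; rewrite pscoefD pscoef1 /pscoef /mixedGF P_nil mulr1.
case: w => [|a w] /=; last by rewrite add0r.
by rewrite ncword_nil -P_nil phiP addr0.
Qed.

(** The three summands are the three kinds of terms in x_i P_v, with i the last
    letter of the word; the constant coefficient is phi[P_v]. *)
Lemma mixedGF_rec (v : seq 'I_d) :
  mixedGF v = lowered v + \sum_i mixedGF (i :: v) * psX i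
    + \sum_i \sum_(w : (size v).-tuple 'I_d)
        mixedGF w * (psX i * psC (B i w v)).
Proof.
apply: psP => w; rewrite !pscoefD !pscoef_sum.
under [X in _ + X]eq_bigr => i _.
  rewrite pscoef_sum; under eq_bigr => u _ do rewrite mulrA pscoefMC.
  over.
case/lastP: w => [|w i].
  rewrite big1 => [|i _]; last by rewrite pscoefMX_nil.
  rewrite big1 => [|i _]; last first.
    by rewrite big1 // => u _; rewrite pscoefMX_nil mul0r.
  rewrite !addr0 {1}/pscoef /mixedGF ncword_nil mul1r phiP.
  by case: v => [|j u] //=; rewrite pscoefMC pscoefMX_nil mul0r.
(* At a word ending in [i] only the summands ending in z_i contribute. *)
rewrite (bigD1 i) //= pscoefMX_rcons eqxx mulr1.
rewrite big1 => [|j /negPf ji]; last first.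
  by rewrite pscoefMX_rcons ji mulr0.
rewrite addr0 (bigD1 i) //=.
rewrite [X in _ + (_ + X)]big1 => [|j /negPf ji]; last first.
  by rewrite big1 // => u _; rewrite pscoefMX_rcons ji mulr0 mul0r.
rewrite addr0.
under eq_bigr => u _ do rewrite pscoefMX_rcons eqxx mulr1.
rewrite {1}/pscoef /mixedGF ncword_rcons -mulrA.
have [_ Prec1 Prec] := P_rec.
case: v => [|j u].
  rewrite P_nil mulr1 Prec1 pscoef1.
  rewrite -[rcons w i == _]size_eq0 size_rcons add0r.
  rewrite mulrDr linearD /=; congr (_ + _).
  rewrite (big_pred1 [tuple]) => [|u]; last first.
    by rewrite (tuple0 u); apply/esym/eqP.
  by rewrite malg_scaleAr linearZ /= mulr1 /pscoef P_nil mulr1 mulrC.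
rewrite /= Prec pscoefMC pscoefMX_rcons.
rewrite !mulrDr !linearD /= addrC addrA; congr (_ + _ + _).
  by rewrite malg_scaleAr linearZ /= /pscoef eq_sym mulrC mulrA.
rewrite mulr_sumr linear_sum /=; apply: eq_bigr => u' _.
by rewrite malg_scaleAr linearZ /= mulrC.
Qed.

Lemma levelrow_rec k :
  levelrow mixedGF k *m (1%:M - \sum_i psX i *: map_mx psC (Tmx B k i)) =
    levelrow lowered k + contract (levelrow mixedGF k.+1).
Proof.
rewrite mulmxBr mulmx1; apply/eqP; rewrite subr_eq; apply/eqP/rowP => a.
rewrite !mxE mixedGF_rec; congr (_ + _ + _).
  by apply: eq_bigr => l _; rewrite mxE mi_val_cons.
under [RHS]eq_bigr => b _ do rewrite mxE summxE mulr_sumr.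
rewrite [RHS]exchange_big /=; apply: eq_bigr => i _.
rewrite (sum_sized_tuple
  (fun w => mixedGF w * (psX i * psC (B i w (mi_val a)))) (size_tuple _)).
by rewrite sum_tuple_mi; apply: eq_bigr => b _; rewrite !mxE.
Qed.

(** Every entry of [lowered] at level k + 1 is an entry of the level-k row times
    z_j and a scalar on its right, so what returns to level k through D^-1 is a
    multiple of the level-k row, and the factor is the fraction with
    denominator D. *)
Lemma contract_loweredV k (D : 'M[S]_('MI_(d, k.+1))) :
  contract (levelrow lowered k.+1 *m ncinvmx D) =
    levelrow mixedGF k *m \sum_j \sum_l
      map_mx (fun s => psX j * s * psX l) (Efrac j l (Cmx c k.+1) D).
Proof.
apply/rowP => b; rewrite !mxE.
under [RHS]eq_bigr => a _.
  rewrite summxE mulr_sumr.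
  under eq_bigr => j _ do rewrite summxE mulr_sumr.
  over.
under [LHS]eq_bigr => l _.
  rewrite mxE sum_mi_cons exchange_big mulr_suml /=.
  under eq_bigr => a _ do rewrite mulr_suml.
  over.
rewrite exchange_big /=; apply: eq_bigr => a _.
rewrite exchange_big /=; apply: eq_bigr => j _; apply: eq_bigr => l _.
rewrite !mxE mi_val_cons /= !mulrA; congr (_ * _).
rewrite -!mulrA; congr (_ * (_ * _)).
rewrite (bigD1 (mi_cons j a)) //= big1 => [|e /negPf ea].
  by rewrite !mxE eqxx mulr1n addr0 mi_val_cons.
by rewrite !mxE eq_sym ea mulr0n; apply: psP => w; rewrite pscoefCM mul0r.
Qed.

(** The truncated denominators satisfy F_k D = L_k up to an error of order r.
    In the induction step the error is the old one times D^-1, then contracted,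
    and the contraction multiplies it by a variable. *)
Lemma levelrow_denom r k : exists E : 'rV[S]_('MI_(d, k)),
  (forall a, vanishes_below r (E 0 a)) /\
  levelrow mixedGF k *m cf_denom B c r k = levelrow lowered k + E.
Proof.
elim: r k => [|r IHr] k /=.
  by exists (contract (levelrow mixedGF k.+1)); split=> //; apply: levelrow_rec.
have [E [E0 FE]] := IHr k.+1; set D := cf_denom B c r k.+1 in FE *.
exists (contract (E *m ncinvmx D)); split.
  move=> a; rewrite mxE; apply: vanishes_below_sum => l.
  apply: vanishes_belowMX; rewrite mxE; apply: vanishes_below_sum => b.
  exact: vanishes_belowM.
rewrite mulmxBr levelrow_rec -contract_loweredV -addrA -contractB.
congr (_ + contract _).
have [DV _] := cf_denomV B c r k.+1.
rewrite -[levelrow mixedGF k.+1]mulmx1 -DV mulmxA FE mulmxDl.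
by rewrite addrC addKr.
Qed.

End Expansion.

Theorem theorem12 (R : realType) (d : nat)
    (phi : {scalar ncpoly R d})
    (P : seq 'I_d -> ncpoly R d)
    (B : 'I_d -> seq 'I_d -> seq 'I_d -> R[i])
    (c : seq 'I_d -> R[i])
    (phi_state : is_state phi)
    (P_MOPS : is_MOPS phi P)
    (P_rec : MOPS_recursion P B c) :
  pslim (cf_trunc B c) (1 + momentGF phi).
Proof.
have phiP v := state_MOPS v phi_state P_MOPS.
have [P0 _ _] := P_MOPS.
move=> w; exists (size w).+1 => N wN.
have [E [E0 FE]] := levelrow_denom phiP P0 P_rec N 0.
rewrite -(mixedGF_nil phiP P0).
have [DV _] := cf_denomV B c N 0.
move/(congr1 (mulmx^~ (ncinvmx (cf_denom B c N 0)))): FE => /=.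
rewrite -mulmxA DV mulmx1 mulmxDl => /rowP /(_ (enum_rank [tuple])).
have mi0 (a : 'I_('MI_(d, 0))) : a = enum_rank [tuple].
  by rewrite -[LHS]enum_valK [enum_val a]tuple0.
have val0 : mi_val (enum_rank [tuple]) = [::] :> seq 'I_d.
  by rewrite /mi_val enum_rankK.
rewrite !mxE val0 => /(congr1 (pscoef w)) ->; rewrite pscoefD.
rewrite [X in _ + X](_ : _ = 0) ?addr0; last first.
  by apply: vanishes_below_sum wN => b; apply: vanishes_belowM.
rewrite (big_pred1 (enum_rank [tuple])) => [|b]; last first.
  by rewrite (mi0 b) /= eqxx.
by rewrite mxE val0 mul1r.
Qed.
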